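(* Let $X$ be a set and let $\Gamma$ be a hypergraph of arity three on $X$ such that there is $d\in\omega$ with the property that for all $x_0,x_1\in X$ the set $\{x_2\in X\colon\{x_0,x_1,x_2\}\in\Gamma\}$ has cardinality at most $d$. Then the finite approximation coloring poset $R(\Gamma)$ is $\langle X,\Gamma\rangle$-definably $\sigma$-Ramsey-centered: there is a sequence $\langle A_k\colon k\in\omega\rangle$ of Ramsey-centered subsets of $R(\Gamma)$, definable from $X$ and $\Gamma$, with $R(\Gamma)=\bigcup_kA_k$.
   Context: The finite approximation coloring poset $R(\Gamma)$ consists of all finite partial functions $p\colon X\to\omega$ such that no hyperedge of $\Gamma$ contained in $\mathrm{dom}(p)$ is $p$-monochromatic, ordered by reverse inclusion. A set $A\subset R$ of a poset $R$ is Ramsey-centered if for every $n\in\omega$ there is $m\in\omega$ such that for every $m$-tuple $\langle r_i\colon i<m\rangle$ of elements of $A$ there is $b\subset m$ of size $n$ such that $\{r_i\colon i\in b\}$ has a common lower bound in $R$. *)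

(* Defs.v *)
From HB Require Import structures.
From mathcomp Require Import all_boot all_order finmap.
From mathcomp Require Import boolp classical_sets functions cardinality.

Set Implicit Arguments.
Unset Strict Implicit.
Unset Printing Implicit Defensive.

Import Order.TTheory.

Local Open Scope classical_set_scope.

(* A cumulative hierarchy of well-founded pure sets (Aczel): [Sup T f] is the
   set { f t | t : T }.  The same set has many presentations, so equality of
   sets is the extensional relation [eqV], not Leibniz equality. *)
Inductive V : Type := Sup (T : Type) (f : T -> V).

Fixpoint eqV (a b : V) {struct a} : Prop :=
  let: Sup T f := a in let: Sup U g := b in
  (forall t, exists u, eqV (f t) (g u)) /\ (forall u, exists t, eqV (f t) (g u)).

Definition memV (a b : V) : Prop := let: Sup U g := b in exists u, eqV a (g u).

Definition emptyV : V := Sup (fun v : void => match v with end).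

Definition setV (T : Type) (A : set T) (f : T -> V) : V :=
  Sup (fun t : {t : T | A t} => f (sval t)).

(* a `|` {a} *)
Definition succV (a : V) : V :=
  let: Sup T f := a in Sup (fun o : option T => if o is Some t then f t else a).

(* von Neumann numerals *)
Definition natV (n : nat) : V := iter n succV emptyV.

Definition upairV (a b : V) : V := Sup (fun c : bool => if c then a else b).

(* Kuratowski pairs *)
Definition pairV (a b : V) : V := upairV (upairV a a) (upairV a b).

(* First-order formulas of the language of set theory, with de Bruijn
   variables; their quantifiers range over all of [V]. *)
Inductive formula : Type :=
  | FMem (i j : nat)
  | FEq (i j : nat)
  | FNot (phi : formula)
  | FAnd (phi psi : formula)
  | FEx (phi : formula).

(* Variables beyond the environment denote the empty set, so they provide no
   additional parameter. *)
Fixpoint sat (env : seq V) (phi : formula) : Prop :=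
  match phi with
  | FMem i j => memV (nth emptyV env i) (nth emptyV env j)
  | FEq i j => eqV (nth emptyV env i) (nth emptyV env j)
  | FNot phi => ~ sat env phi
  | FAnd phi psi => sat env phi /\ sat env psi
  | FEx phi => exists a : V, sat (a :: env) phi
  end.

Definition definable_from (params : seq V) (a : V) : Prop :=
  exists phi : formula, forall b : V, sat (b :: params) phi <-> eqV b a.

Definition hypergraph (X : choiceType) (n : nat) (Gamma : set {fset X}) : Prop :=
  forall s, Gamma s -> #|` s| = n.

Definition ramsey_centered (disp : Order.disp_t) (R : porderType disp)
    (A : set R) : Prop :=
  forall n : nat, exists m : nat, forall r : 'I_m -> R, (forall i, A (r i)) ->
    exists b : {set 'I_m}, #|b| = n /\
      exists q : R, forall i, i \in b -> (q <= r i)%O.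

Section ColoringPoset.
Variables (X : choiceType) (Gamma : set {fset X}).

Definition monochromatic (p : {fmap X -> nat}) (s : {fset X}) : Prop :=
  forall x y, x \in s -> y \in s -> p.[? x]%fmap = p.[? y]%fmap.

Definition partial_coloring (p : {fmap X -> nat}) : Prop :=
  forall s, Gamma s -> (s `<=` domf p)%fset -> ~ monochromatic p s.

Definition coloring_poset : Type :=
  {p : {fmap X -> nat} | `[< partial_coloring p >]}.

HB.instance Definition _ := [Choice of coloring_poset by <:].

(* the inclusion of graphs q \subset p *)
Definition coloring_le (p q : coloring_poset) : bool :=
  [forall x : domf (val q), (val p).[? val x]%fmap == Some (val q x)].

Lemma coloring_leP (p q : coloring_poset) :
  reflect (forall x n, (val q).[? x]%fmap = Some n -> (val p).[? x]%fmap = Some n)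
          (coloring_le p q).
Proof.
apply: (iffP forallP) => [pq x n|pq x].
  by case: fndP => // xq [<-]; apply/eqP; exact: (pq [` xq]%fset).
by apply/eqP/pq; rewrite Some_fnd.
Qed.

Lemma coloring_le_refl : reflexive coloring_le.
Proof. by move=> p; apply/coloring_leP. Qed.

Lemma coloring_le_anti : antisymmetric coloring_le.
Proof.
move=> p q /andP[/coloring_leP pq /coloring_leP qp]; apply/val_inj/fmapP => x.
case Ep: (_.[? x])%fmap => [n|]; first by rewrite (qp _ _ Ep).
by case Eq: (_.[? x])%fmap => [n|//]; rewrite -Ep (pq _ _ Eq).
Qed.

Lemma coloring_le_trans : transitive coloring_le.
Proof.
move=> q p r /coloring_leP pq /coloring_leP qr.
by apply/coloring_leP => x n /qr/pq.
Qed.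

Fact coloring_display : Order.disp_t. Proof. exact: (Order.Disp tt tt). Qed.

HB.instance Definition _ := Order.Le_isPOrder.Build coloring_display
  coloring_poset coloring_le_refl coloring_le_anti coloring_le_trans.

(* The carrier X is realized as a set of the hierarchy, namely as the image of
   an injection iota : X -> V.  The following are the corresponding sets of
   the hierarchy. *)
Variable iota : X -> V.

Definition carrierV : V := setV [set: X] iota.

Definition fsetV (s : {fset X}) : V := setV [set x | x \in s] iota.

Definition hypergraphV : V := setV Gamma fsetV.

Definition fmapV (p : {fmap X -> nat}) : V :=
  Sup (fun x : domf p => pairV (iota (val x)) (natV (p x))).

Definition sequenceV (A : nat -> set coloring_poset) : V :=
  setV [set: nat] (fun k => pairV (natV k) (setV (A k) (fun p => fmapV (val p)))).

Definition definably_sigma_ramsey_centered : Prop :=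
  exists A : nat -> set coloring_poset,
    [/\ forall k, ramsey_centered (A k),
        [set: coloring_poset] = \bigcup_k A k
      & definable_from [:: carrierV; hypergraphV] (sequenceV A)].

End ColoringPoset.

(* Main.v *)
(** Let A_k consist of the colorings p with |dom p| <= k and all colors < k.
    Given many members of A_k, a delta-system argument on their graphs yields a
    large subfamily with a common root K such that every vertex outside dom K
    lies in boundedly many domains.  Say that j attacks i if dom p_i, outside
    dom K, meets dom p_j or contains the third vertex of a hyperedge having two
    vertices in dom p_j.  The degree bound on Gamma makes out-degrees of this
    digraph bounded, so averaging gives a large independent set.  Likewise any
    two indices are completed by boundedly many indices to a triple with a
    hyperedge having one vertex in each of the three domains, outside dom K; so
    a maximal family without such triples is large.  In the resulting
    subfamily every hyperedge inside the union of the domains lies in a single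
    domain, so the union of the colorings is a common lower bound.

    The sequence of the A_k is first-order definable outright, which requires
    only translating its description into the language of set theory. *)

Require Import Defs.
From HB Require Import structures.
From mathcomp Require Import all_boot all_order finmap.
From mathcomp Require Import boolp classical_sets functions cardinality.

Set Implicit Arguments.
Unset Strict Implicit.
Unset Printing Implicit Defensive.

Import Order.TTheory.

Local Open Scope classical_set_scope.
Local Open Scope card_scope.

(** * Independent sets and delta-systems *)

(** Union bound. Nested uses count the indices reached through several successive choices. *)
Lemma card_has_le (I : finType) (T : eqType) (S : {set I}) (Q : I -> T -> bool)
    (s : seq T) (A B : nat) : size s <= A ->
  (forall x, x \in s -> #|[set i in S | Q i x]| <= B) ->
  #|[set i in S | has (Q i) s]| <= A * B.
Proof.
move=> sA sB; apply: leq_trans (leq_mul sA (leqnn B)).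
elim: s sB {sA} => [|x s IHs] sB /=.
  by rewrite leqn0 cards_eq0; apply/eqP/setP => i; rewrite !inE andbF.
rewrite mulSn; have -> : [set i in S | Q i x || has (Q i) s] =
    [set i in S | Q i x] :|: [set i in S | has (Q i) s].
  by apply/setP => i; rewrite !inE andb_orr.
rewrite (leq_trans (leq_card_setU _ _))// leq_add ?sB ?mem_head//.
by apply: IHs => y ys; apply: sB; rewrite inE ys orbT.
Qed.

(** In-degrees and out-degrees within [S] have the same sum, at most [#|S| * D], so the in-degrees
    cannot all exceed [D]. *)
Lemma exists_low_indegree (I : finType) (S : {set I}) (e : rel I) (D : nat) :
  (forall i, i \in S -> #|[set j in S | e i j]| <= D) -> 0 < #|S| ->
  exists2 j, j \in S & #|[set i in S | e i j]| <= D.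
Proof.
move=> eD S0; apply: contrapT => noj.
have deg (f : rel I) : \sum_(i in S) #|[set j in S | f i j]| =
    \sum_(i in S) \sum_(j in S) f i j.
  apply: eq_bigr => i _; rewrite -sum1dep_card big_mkcondr /=.
  by apply: eq_bigr => j _; case: f.
have le_out : \sum_(i in S) #|[set j in S | e i j]| <= #|S| * D.
  by rewrite -sum_nat_const leq_sum.
have ge_in : #|S| * D.+1 <= \sum_(j in S) #|[set i in S | e i j]|.
  rewrite -sum_nat_const leq_sum// => j jS; rewrite ltnNge.
  by apply/negP => jD; apply: noj; exists j.
have := leq_trans ge_in; rewrite (deg (fun j i => e i j)) exchange_big -deg.
by move=> /(_ _ le_out); rewrite leq_pmul2l// ltnn.
Qed.

(** Greedy choice: a vertex of in-degree at most [D] is kept and its neighbours in both directions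
    are discarded. Each round costs at most [(D + D).+1] vertices, and out-degree bounds pass to
    subsets. *)
Lemma digraph_independent_set (I : finType) (e : rel I) (D n : nat)
    (S : {set I}) :
  (forall i, i \in S -> #|[set j in S | e i j]| <= D) ->
  n * (D + D).+1 <= #|S| ->
  exists b : {set I}, [/\ b \subset S, n <= #|b| &
    forall i j, i \in b -> j \in b -> i != j -> ~~ e i j].
Proof.
elim: n S => [|n IHn] S eD Sn.
  by exists finset.set0; split=> [||i j]; rewrite ?finset.sub0set ?inE.
have [|i iS inD] := exists_low_indegree eD; first by apply: leq_trans Sn.
pose N := i |: ([set j in S | e i j] :|: [set j in S | e j i]).
have cN : #|N| <= (D + D).+1.
  rewrite -add1n cardsU1 leq_add//; first by case: (_ \notin _).
  by rewrite (leq_trans (leq_card_setU _ _))// leq_add// eD.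
have [|| b [bS nb be]] := IHn (S :\: N).
- move=> j; rewrite finset.in_setD => /andP[_ jS]; apply: leq_trans (eD j jS).
  by apply/subset_leq_card/fintype.subsetP => l; rewrite !inE => /andP[/andP[_ ->]].
- have : #|S :&: N| <= (D + D).+1.
    by apply: leq_trans cN; rewrite subset_leq_card// finset.subsetIr.
  move: Sn; rewrite mulSn -(cardsID N S) => Sn SN.
  by rewrite -(leq_add2l (D + D).+1) (leq_trans Sn)// leq_add2r.
have bN j : j \in b -> [/\ j \in S, j != i, ~~ e i j & ~~ e j i].
  move=> /(fintype.subsetP bS); rewrite !inE !negb_or !negb_and => /andP[+ jS].
  by rewrite jS /= => /and3P[].
exists (i |: b); split.
- by apply/fintype.subsetP => j /setU1P[->//|/bN[]].
- rewrite cardsU1; case: (boolP (i \in b)) => [/bN[_]|_]; first by rewrite eqxx.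
  by rewrite add1n ltnS.
- move=> j l /setU1P[->|jb] /setU1P[->|lb]; rewrite ?eqxx//.
  + by case: (bN _ lb).
  + by case: (bN _ jb).
  + exact: be.
Qed.

(** Let [b] be independent of maximal size. Each [l] in [S] outside [b] completes two members of [b]
    to a triple, since otherwise it could be added; hence [#|S|] is at most
    [#|b| + #|b| * (#|b| * D)]. *)
Lemma triple_system_independent_set (I : finType) (t : I -> I -> I -> bool)
    (D n : nat) (S : {set I}) :
  (forall i j l, t i j l = t j i l) -> (forall i j l, t i j l = t i l j) ->
  (forall i j, i \in S -> j \in S -> #|[set l in S | t i j l]| <= D) ->
  n + n * (n * D) <= #|S| ->
  exists b : {set I}, [/\ b \subset S, n <= #|b| &
    forall i j l, i \in b -> j \in b -> l \in b -> uniq [:: i; j; l] ->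
      ~~ t i j l].
Proof.
move=> t12 t23 tD Sn.
pose indep (b : {set I}) := (b \subset S) && [forall i in b, forall j in b,
  forall l in b, uniq [:: i; j; l] ==> ~~ t i j l].
have indepP (b : {set I}) : reflect (b \subset S /\ forall i j l, i \in b ->
    j \in b -> l \in b -> uniq [:: i; j; l] -> ~~ t i j l) (indep b).
  apply: (iffP andP) => -[bS bt]; split=> //.
    move=> i j l ib jb lb; move: bt.
    by move=> /'forall_in_'forall_in_forall_inP/(_ i ib j jb l lb)/implyP.
  by apply/'forall_in_'forall_in_forall_inP => i ib j jb l lb; apply/implyP/bt.
have indep0 : indep finset.set0.
  by apply/indepP; split=> [|i]; rewrite ?finset.sub0set ?inE.
case: (arg_maxnP (fun b : {set I} => #|b|) indep0) => b /indepP[bS bt] bmax.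
exists b; split=> //; rewrite leqNgt; apply/negP => bn.
pose Q l i := has (fun j => t i j l) (enum b).
have SQ : S :\: b \subset [set l in S | has (Q l) (enum b)].
  apply/fintype.subsetP => l; rewrite !inE => /andP[lb lS]; rewrite lS /=.
  apply/negPn/negP => noQ.
  have nt i j : i \in b -> j \in b -> ~~ t i j l.
    move=> ib jb; apply: contra noQ => tijl; apply/hasP; exists i.
      by rewrite mem_enum.
    by apply/hasP; exists j; rewrite // mem_enum.
  suff : indep (l |: b) by move=> /bmax /=; rewrite cardsU1 lb leqNgt ltnS leqnn.
  apply/indepP; split.
    by apply/fintype.subsetP => j /setU1P[->//|/(fintype.subsetP bS)].
  (* Cases by which indices are the new [l]: a repeated [l] contradicts [uniq], and the symmetries
     move a single [l] to the last place. *)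
  move=> i j h /setU1P[->|ib] /setU1P[->|jb] /setU1P[->|hb];
    rewrite /= !inE ?eqxx ?orbT ?andbF//= => u.
  - by rewrite t12 t23 nt.
  - by rewrite t23 nt.
  - exact: nt.
  - by apply: bt; rewrite //= !inE.
suff : #|S| <= #|b| + #|b| * (#|b| * D).
  apply/negP; rewrite -ltnNge; apply: leq_trans Sn; rewrite -addSn leq_add//.
  by rewrite leq_mul ?(ltnW bn)// leq_mul// ltnW.
rewrite -(cardsID b S) leq_add//.
  by rewrite subset_leq_card// finset.subsetIr.
apply: leq_trans (subset_leq_card SQ) _.
apply: (card_has_le (Q := Q)) => [|i]; first by rewrite cardE.
rewrite mem_enum => ib; apply: card_has_le => [|j]; first by rewrite cardE.
by rewrite mem_enum => jb; apply: tD; exact: (fintype.subsetP bS).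
Qed.

(* Requiring [f M] sets rather than a fixed number lets the size of the
   subfamily depend on the multiplicity [M] that it guarantees; a maximal root
   [K'] then does the job without making the sets disjoint outside [K']. *)
Lemma weak_delta_system (T : choiceType) (f : nat -> nat) (k : nat) :
  exists m, forall (I : finType) (G : I -> {fset T}) (S : {set I})
    (K : {fset T}),
    (forall i, i \in S -> K `<=` G i /\ #|` G i| <= #|` K| + k)%fset ->
    m <= #|S| ->
    exists (M : nat) (b : {set I}) (K' : {fset T}),
      [/\ b \subset S, f M <= #|b|, forall i, i \in b -> (K' `<=` G i)%fset &
        forall t, t \notin K' -> #|[set i in b | t \in G i]| <= M].
Proof.
elim: k => [|k [m IHk]].
  (* For [k = 0] every [G i] equals [K], so nothing lies outside the root. *)
  exists (f 0) => I G S K SK fS; exists 0, S, K; split=> // [i /SK[]//|t tK].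
  rewrite leqn0 cards_eq0; apply/eqP/setP => i; rewrite !inE.
  apply/negP => /andP[/SK[Ki]]; rewrite addn0 => cK.
  by have /eqP <- : K == G i by [rewrite eqEfcard Ki]; move=> tK'; rewrite tK' in tK.
exists (f m) => I G S K SK fS.
(* Either [K] itself works with [M = m], whence the threshold [f m], or some [t] outside [K] lies in
   more than [m] of the sets. These sets contain the root enlarged by [t] and have one element fewer
   outside it. *)
have [tm|] := pselect (forall t, t \notin K -> #|[set i in S | t \in G i]| <= m).
  by exists m, S, K; split=> // i /SK[].
move=> /existsNP[t /not_implyP[tK /negP]]; rewrite -ltnNge => /ltnW mt.
have [|M [b [K' [bS fb bK' K'M]]]] := IHk I G _ (t |` K)%fset _ mt.
  move=> i; rewrite inE => /andP[/SK[Ki ki] ti]; split.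
    by apply/fsubsetP => u /fset1UP[->//|]; exact: (fsubsetP Ki).
  by rewrite cardfsU1 tK add1n addSnnS.
exists M, b, K'; split=> //; apply: fintype.subset_trans bS _.
by apply/fintype.subsetP => i; rewrite inE => /andP[].
Qed.

(** * Common lower bounds of bounded colorings *)

(** Serves both to glue colorings and to read a coloring off a set of the hierarchy. [P] need not be
    decidable, so domain and values are found classically. *)
Lemma fmap_of_rel (X : choiceType) (D : {fset X}) (P : X -> nat -> Prop) :
  (forall x c, P x c -> x \in D) ->
  (forall x c c', P x c -> P x c' -> c = c') ->
  exists q : {fmap X -> nat}, forall x c, q.[? x]%fmap = Some c <-> P x c.
Proof.
move=> PD Pfun.
pose E := [fset x in D | `[< exists c, P x c >]]%fset.
exists [fmap x : E => xget 0 (P (val x))]%fmap => x c.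
case: fndP => [xE|xE].
  have := xE; rewrite in_fset !inE => /andP[_ /asboolP[c0 Pc0]].
  rewrite ffunE /=; have Pg := xgetPex 0 (ex_intro (P x) c0 Pc0).
  by split=> [[<-]//|Pc]; congr Some; exact: Pfun Pc.
split=> // Pc; case/negP: xE; rewrite in_fset !inE (PD _ _ Pc) /=.
by apply/asboolP; exists c.
Qed.

Lemma fset3P (X : choiceType) (s : {fset X}) : #|` s| = 3 ->
  exists x y z, s = [fset x; y; z]%fset.
Proof.
move=> s3; have : size s = 3 by [].
case E : (enum_fset s) => [|x [|y [|z [|]]]]// _.
exists x, y, z; apply/fsetP => u.
by rewrite !inE -[u \in s]/(u \in enum_fset s) E !inE orbA.
Qed.

(** Bounding the colors leaves only [k] possible graph points above each vertex, so that
    multiplicity bounds for graph points become bounds for vertices. *)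
Definition bounded_colorings (X : choiceType) (Gamma : set {fset X}) (k : nat) :
    set (coloring_poset Gamma) :=
  [set p | (#|` domf (val p)| <= k)%N /\
           forall x c, (val p).[? x]%fmap = Some c -> c < k].
Arguments bounded_colorings [X] Gamma k.

(** A delta-system of graphs, unlike one of domains, makes the colorings agree on the root. The
    default [0] is never taken, as [x] ranges over [domf p]. *)
Definition graph (X : choiceType) (p : {fmap X -> nat}) : {fset X * nat} :=
  [fset (x, odflt 0 p.[? x]%fmap) | x in domf p]%fset.

Lemma in_graph (X : choiceType) (p : {fmap X -> nat}) x c :
  ((x, c) \in graph p) = (p.[? x]%fmap == Some c).
Proof.
apply/imfsetP/eqP => /= [[y yp [-> ->]]|pxc].
  by case: fndP => //; rewrite yp.
by exists x; rewrite ?pxc// -fndSome pxc.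
Qed.

Lemma domf_fnd (X : choiceType) (p : {fmap X -> nat}) x :
  x \in domf p -> exists c, p.[? x]%fmap = Some c.
Proof. by move=> xp; exists p.[xp]%fmap; rewrite in_fnd. Qed.

Lemma fnd_domf (X : choiceType) (p : {fmap X -> nat}) x c :
  p.[? x]%fmap = Some c -> x \in domf p.
Proof. by move=> pxc; rewrite -fndSome pxc. Qed.

Lemma bounded_colorings_cover (X : choiceType) (Gamma : set {fset X}) :
  [set: coloring_poset Gamma] = \bigcup_k bounded_colorings Gamma k.
Proof.
apply/seteqP; split=> // p _.
pose m := \max_(x : domf (val p)) val p x.
exists (maxn #|` domf (val p)| m.+1) => //; split=> [|x c]; first exact: leq_maxl.
case: fndP => // xp [<-]; rewrite leq_max ltnS; apply/orP; right.
exact: (leq_bigmax [` xp]%fset).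
Qed.

Section Combinatorics.
Variables (X : choiceType) (Gamma : set {fset X}).
Hypothesis Gamma3 : hypergraph 3 Gamma.

(** The union of the colorings is the bound. A monochromatic hyperedge cannot lie in one domain, so
    its vertices would be split among domains as two and one or as three single ones; the last two
    hypotheses rule this out. *)
Lemma exists_common_lower_bound (I : finType) (r : I -> coloring_poset Gamma)
    (K : set X) (b : {set I}) :
  (forall i j x, i \in b -> j \in b -> K x ->
    (val (r i)).[? x]%fmap = (val (r j)).[? x]%fmap) ->
  (forall i j z, i \in b -> j \in b -> i != j -> z \in domf (val (r i)) ->
    z \in domf (val (r j)) -> K z) ->
  (forall i j x y z, i \in b -> j \in b -> i != j -> x \in domf (val (r i)) ->
    y \in domf (val (r i)) -> z \in domf (val (r j)) ->
    Gamma [fset x; y; z]%fset -> K z) ->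
  (forall i j l x y z, i \in b -> j \in b -> l \in b -> uniq [:: i; j; l] ->
    x \in domf (val (r i)) -> y \in domf (val (r j)) ->
    z \in domf (val (r l)) -> ~ K x -> ~ K y -> ~ K z ->
    ~ Gamma [fset x; y; z]%fset) ->
  exists q : coloring_poset Gamma, forall i, i \in b -> (q <= r i)%O.
Proof.
move=> rK r2 r21 r111.
pose P x c := exists2 i, i \in b & (val (r i)).[? x]%fmap = Some c.
have [x c [i ib] /fnd_domf xi|x c c' [i ib ric] [j jb rjc]|q qP] :=
    @fmap_of_rel X (\bigcup_(i in b) domf (val (r i)))%fset P.
- by apply/bigfcupP; exists i; rewrite // mem_index_enum ib.
- case: (eqVneq i j) ric => [-> rjc'|ij ric].
    by move: rjc'; rewrite rjc => -[].
  have Kx := r2 i j x ib jb ij (fnd_domf ric) (fnd_domf rjc).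
  by move: ric; rewrite (rK i j x)// rjc => -[].
have q_ge i x c : i \in b -> (val (r i)).[? x]%fmap = Some c ->
    q.[? x]%fmap = Some c by move=> ib ric; apply/qP; exists i.
suff q_col : partial_coloring Gamma q.
  exists (exist _ q (asboolT q_col)) => i ib.
  by apply/coloring_leP => x c; exact: q_ge.
move=> s Gs /fsubsetP sq mono.
have nosub i : i \in b -> ~ (s `<=` domf (val (r i)))%fset.
  move=> ib /fsubsetP si; have /asboolP/(_ s Gs) := valP (r i).
  apply; first exact/fsubsetP.
  move=> x y xs ys; have [c xc] := domf_fnd (si _ xs).
  have [c' yc'] := domf_fnd (si _ ys).
  rewrite xc yc' -(q_ge i x c)// -(q_ge i y c')//; exact: mono.
have domK i j x : i \in b -> j \in b -> K x -> x \in domf (val (r i)) ->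
    x \in domf (val (r j)).
  by move=> ib jb Kx; rewrite -!fndSome (rK i j x).
(* If [i] and [j] differ, the third vertex is in [K], hence in the domain of [r i] as well, and the
   whole hyperedge lies in one domain. *)
have no21 i j x y z : i \in b -> j \in b -> x \in domf (val (r i)) ->
    y \in domf (val (r i)) -> z \in domf (val (r j)) -> s <> [fset x; y; z]%fset.
  move=> ib jb xi yi zj sE; apply: (nosub i) => //.
  have zi : z \in domf (val (r i)).
    have [<-//|ij] := eqVneq j i; apply: (domK j) => //.
    by apply: (r21 i j x y z) => //; [rewrite eq_sym|rewrite -sE].
  by apply/fsubsetP => u; rewrite sE !inE -orbA => /or3P[]/eqP->.
have [x [y [z sE]]] := fset3P (Gamma3 Gs).
have sE1 : s = [fset x; z; y]%fset.
  by rewrite sE; apply/fsetP => u; rewrite !inE orbAC.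
have sE2 : s = [fset y; z; x]%fset.
  by rewrite sE; apply/fsetP => u; rewrite !inE -orbA orbC.
have sdom u : u \in s -> exists2 i, i \in b & u \in domf (val (r i)).
  move=> us; have [c /qP[i ib ric]] := domf_fnd (sq u us).
  by exists i => //; apply: fnd_domf ric.
have [i ib xi] : exists2 i, i \in b & x \in domf (val (r i)).
  by apply: sdom; rewrite sE !inE eqxx.
have [j jb yj] : exists2 j, j \in b & y \in domf (val (r j)).
  by apply: sdom; rewrite sE !inE eqxx orbT.
have [l lb zl] : exists2 l, l \in b & z \in domf (val (r l)).
  by apply: sdom; rewrite sE !inE eqxx !orbT.
(* A vertex in [K] belongs to every domain of the family, so it would share one with another vertex
   of [s], against [no21]. *)
have Kx : ~ K x.
  by move=> /(domK i j x ib jb)/(_ xi) xj; exact: (no21 j l x y z).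
have Ky : ~ K y.
  by move=> /(domK j i y jb ib)/(_ yj) yi; exact: (no21 i l x y z).
have Kz : ~ K z.
  by move=> /(domK l i z lb ib)/(_ zl) zi; exact: (no21 i j x z y).
have [ij|ij] := eqVneq i j; first by apply: (no21 j l x y z) => //; rewrite -ij.
have [il|il] := eqVneq i l; first by apply: (no21 l j x z y) => //; rewrite -il.
have [jl|jl] := eqVneq j l; first by apply: (no21 l i y z x) => //; rewrite -jl.
apply: (r111 i j l x y z) => //; last by rewrite -sE.
by rewrite /= !inE negb_or ij il jl.
Qed.

Variable d : nat.
Hypothesis Gamma_bounded : forall x0 x1 : X,
  [set x2 : X | Gamma [fset x0; x1; x2]%fset] #<= `I_d.

(** [fset_set] is faithful only on finite sets, which the bound [d] guarantees here. *)
Let thirds x y := fset_set [set z : X | Gamma [fset x; y; z]%fset].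

Let mem_thirds x y z : Gamma [fset x; y; z]%fset -> z \in thirds x y.
Proof.
move=> Gxyz; rewrite in_fset_set ?inE//.
by apply/finite_set_leP; exists d.
Qed.

Let size_thirds x y : size (thirds x y) <= d.
Proof. exact: geq_card_fset_set. Qed.

Lemma bounded_colorings_ramsey_centered (k : nat) :
  ramsey_centered (bounded_colorings Gamma k).
Proof.
move=> n.
(* [B3] counts two vertices from given domains, a third vertex completing them, and the domains
   containing it. [B2] adds the domains met directly. [N] composes the thresholds of the two
   independent-set lemmas, the triple system being treated last. *)
pose B3 M := k * (k * (d * (k * M))); pose B2 M := k * (k * M) + B3 M.
pose N M := (n + n * (n * B3 M)) * (B2 M + B2 M).+1.
have [m delta] := weak_delta_system (X * nat)%type N k.
exists m => r rA.
have [i _||M [b0 [K [_ Nb0 b0K b0M]]]] :=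
    delta _ (fun i => graph (val (r i))) [set: 'I_m]%SET fset0.
- rewrite fsub0set cardfs0 add0n; split=> //.
  by apply: leq_trans (leq_imfset_card _ _ _) _; case: (rA i).
- by rewrite cardsT card_ord.
pose domK := [fset t.1 | t in K]%fset.
pose P i z := (z \in domf (val (r i))) && (z \notin domK).
(* If [z] is outside [domK], no point [(z, c)] is in the root, so each lies in at most [M] graphs,
   and only [k] colors [c] occur. *)
have cP z : #|[set i in b0 | P i z]| <= k * M.
  have [zK|zK] := boolP (z \in domK).
    rewrite (_ : [set i in b0 | P i z]%SET = finset.set0) ?cards0//.
    by apply/setP => i; rewrite !inE /P zK !andbF.
  apply: leq_trans (card_has_le (S := b0) (s := iota 0 k)
      (Q := fun i c => (z, c) \in graph (val (r i))) _ _); last 2 first.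
  - by rewrite size_iota.
  - move=> c _; apply: b0M; apply: contra zK => zcK.
    by apply/imfsetP; exists (z, c).
    apply/subset_leq_card/fintype.subsetP => i; rewrite !inE.
    move=> /andP[-> /andP[zi _]].
    have [c zc] := domf_fnd zi; apply/hasP; exists c; last by rewrite in_graph zc.
    by rewrite mem_iota; case: (rA i) => _ /(_ _ _ zc).
have cdom i : size (domf (val (r i))) <= k by case: (rA i).
pose h i j l := has (fun x => has (fun y => has (P l) (thirds x y))
  (domf (val (r j)))) (domf (val (r i))).
have ch i j : #|[set l in b0 | h i j l]| <= B3 M.
  apply: card_has_le => // x _.
  apply: (card_has_le (Q := fun l y => has (P l) (thirds x y))) => // y _.
  exact: card_has_le.
(* The attack relation; taking both vertices from the same domain, [h i i l] captures the hyperedges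
   split as two and one. *)
pose e i l := has (P l) (domf (val (r i))) || h i i l.
have ce i : i \in b0 -> #|[set l in b0 | e i l]| <= B2 M.
  move=> _; rewrite (_ : [set l in b0 | e i l]%SET =
      [set l in b0 | has (P l) (domf (val (r i)))]%SET :|:
      [set l in b0 | h i i l]%SET)%SET.
    by rewrite (leq_trans (leq_card_setU _ _))// leq_add// card_has_le.
  by apply/setP => l; rewrite !inE andb_orr.
have [b1 [b10 Nb1 b1e]] := digraph_independent_set ce Nb0.
(* Unlike in [h], all three vertices must avoid [domK]. This makes [t] symmetric, and it implies
   [h], which supplies the count. *)
pose t i j l := `[< exists x y z, [/\ P i x, P j y, P l z &
  Gamma [fset x; y; z]%fset] >].
have t12 i j l : t i j l = t j i l.
  by apply/asboolP/asboolP => -[x [y [z [? ? ?]]]]; exists y, x, z;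
    rewrite [X in Gamma (X `|` _)%fset]fsetUC.
have t23 i j l : t i j l = t i l j.
  by apply/asboolP/asboolP => -[x [y [z [? ? ?]]]]; exists x, z, y;
    rewrite fsetUAC.
have [|b2 [b21 nb2 b2t]] := triple_system_independent_set (D := B3 M) t12 t23 _ Nb1.
  move=> i j _ _; apply: leq_trans (ch i j).
  apply/subset_leq_card/fintype.subsetP => l; rewrite !inE.
  move=> /andP[/(fintype.subsetP b10)-> /asboolP[x [y [z []]]]].
  move=> /andP[xi _] /andP[yj _] Pz G.
  apply/hasP; exists x => //; apply/hasP; exists y => //; apply/hasP; exists z => //.
  exact: mem_thirds.
(* Trim the independent set to exactly [n] indices. *)
have /card_geqP[s [us ss sb2]] := nb2.
exists [set i in s]%SET; split; first by rewrite cardsE (card_uniqP us).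
have sb1 i : i \in [set i in s]%SET -> i \in b1.
  by rewrite inE => /sb2; apply: fintype.subsetP.
apply: (@exists_common_lower_bound _ r [set` domK]).
- move=> i j x /sb1/(fintype.subsetP b10) ib /sb1/(fintype.subsetP b10) jb.
  move=> /imfsetP[[u c] /= uK ->].
  have /fsubsetP/(_ _ uK) := b0K i ib; rewrite in_graph => /eqP->.
  by have /fsubsetP/(_ _ uK) := b0K j jb; rewrite in_graph => /eqP->.
- move=> i j z /sb1 ib /sb1 jb ij zi zj; have := b1e i j ib jb ij.
  rewrite negb_or => /andP[/hasPn/(_ _ zi)].
  by rewrite /P zj /= negbK.
- move=> i j x y z /sb1 ib /sb1 jb ij xi yi zj Gxyz; have := b1e i j ib jb ij.
  rewrite negb_or => /andP[_ /hasPn/(_ _ xi)/hasPn/(_ _ yi)].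
  by move=> /hasPn/(_ _ (mem_thirds Gxyz)); rewrite /P zj /= negbK.
move=> i j l x y z; rewrite !inE => /sb2 ib /sb2 jb /sb2 lb u xi yj zl
  /negP xK /negP yK /negP zK Gxyz.
have /asboolP := b2t i j l ib jb lb u; apply; exists x, y, z.
by split=> //; apply/andP.
Qed.

End Combinatorics.

(** * Definability in the cumulative hierarchy *)

Lemma eqV_refl a : eqV a a.
Proof. by elim: a => T f IHf /=; split=> t; exists t. Qed.

Lemma eqV_sym a b : eqV a b -> eqV b a.
Proof.
elim: a b => T f IHf [U g] /= [fg gf]; split=> [u|t].
  by have [t /IHf] := gf u; exists t.
by have [u /IHf] := fg t; exists u.
Qed.

Lemma eqV_trans b a c : eqV a b -> eqV b c -> eqV a c.
Proof.
elim: a b c => T f IHf [U g] [W h] /= [fg gf] [gh hg]; split=> [t|w].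
  by have [u fgu] := fg t; have [w ghw] := gh u; exists w; apply: IHf ghw.
by have [u ghu] := hg w; have [t fgt] := gf u; exists t; apply: IHf ghu.
Qed.

Lemma memVP a b : memV a b <-> exists2 x, eqV a x & memV x b.
Proof.
case: b => U g /=; split=> [[u au]|[x ax [u xu]]].
  by exists (g u) => //; exists u; apply: eqV_refl.
by exists u; apply: eqV_trans xu.
Qed.

Lemma eqVP a b : eqV a b <-> forall x, memV x a <-> memV x b.
Proof.
case: a b => [T f] [U g] /=; split=> [[fg gf] x|fg].
  split=> [[t xt]|[u xu]].
    by have [u tu] := fg t; exists u; apply: eqV_trans tu.
  by have [t /eqV_sym tu] := gf u; exists t; apply: eqV_trans tu.
split=> [t|u]; first by apply/fg; exists t; apply: eqV_refl.
by have [|t /eqV_sym] := (fg (g u)).2; [exists u; apply: eqV_refl|exists t].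
Qed.

Lemma memV_eq a a' b b' : eqV a a' -> eqV b b' -> memV a b -> memV a' b'.
Proof. by move=> /eqV_sym aa' /eqVP bb' ab; apply/bb'/memVP; exists a. Qed.

(** If [a] belongs to itself, it equals one of its members [f t], which then belongs to itself,
    against the induction hypothesis. *)
Lemma memV_irrefl a : ~ memV a a.
Proof.
elim: a => T f IHf [t ft]; apply: (IHf t).
by apply: (memV_eq ft ft); exists t.
Qed.

Lemma memV_setV (T : Type) (A : set T) (f : T -> V) x :
  memV x (setV A f) <-> exists2 t, A t & eqV x (f t).
Proof. by split=> [[[t At] /= xt]|[t At xt]]; [exists t|exists (exist _ t At)]. Qed.

Lemma memV_upairV a b x : memV x (upairV a b) <-> eqV x a \/ eqV x b.
Proof.
by split=> [[[] ?]|[?|?]]; [left|right|exists true|exists false].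
Qed.

Lemma memV_succV a x : memV x (succV a) <-> memV x a \/ eqV x a.
Proof.
case: a => T f /=; split=> [[[t|]]|[[t]|]]; [by left; exists t|by right| |].
  by exists (Some t).
by exists None.
Qed.

Lemma memV_natV n x : memV x (natV n) <-> exists2 i, i < n & eqV x (natV i).
Proof.
elim: n => [|n IHn]; first by split=> [[]|[]].
rewrite [natV _]/(succV (natV n)) memV_succV IHn.
split=> [[[i /ltnW]|xn]|[i]]; [by exists i|by exists n|].
by rewrite ltnS leq_eqVlt => /predU1P[->|]; [right|left; exists i].
Qed.

(** A smaller numeral is a member of a larger one, so equality would make it a member of itself. *)
Lemma natV_inj i j : eqV (natV i) (natV j) -> i = j.
Proof.
suff lt_neq m n : m < n -> ~ eqV (natV m) (natV n).
  by case: (ltngtP i j) => // [/lt_neq|/lt_neq + /eqV_sym].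
move=> mn e; apply: (@memV_irrefl (natV m)).
apply: memV_eq (eqV_refl _) (eqV_sym e) _.
by apply/memV_natV; exists m => //; apply: eqV_refl.
Qed.

Lemma upairV_congr a a' b b' :
  eqV a a' -> eqV b b' -> eqV (upairV a b) (upairV a' b').
Proof.
by move=> aa' bb' /=; split=> -[];
  [exists true|exists false|exists true|exists false].
Qed.

Lemma pairV_congr a a' b b' :
  eqV a a' -> eqV b b' -> eqV (pairV a b) (pairV a' b').
Proof. by move=> aa' bb'; do 2! apply: upairV_congr. Qed.

(** The singleton of [a] matches a set containing [a'], so [a] equals [a']. The second coordinates
    then agree directly, or [b] equals [a'] and [a] equals [b'], so that all four coincide. *)
Lemma pairV_inj a a' b b' :
  eqV (pairV a b) (pairV a' b') -> eqV a a' /\ eqV b b'.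
Proof.
have upairE x y x' y' : eqV (upairV x y) (upairV x' y') ->
    [/\ eqV x x' \/ eqV x y', eqV y x' \/ eqV y y',
        eqV x x' \/ eqV y x' & eqV x y' \/ eqV y y'].
  move=> /eqVP e; split.
  - by apply/memV_upairV/e/memV_upairV; left; apply: eqV_refl.
  - by apply/memV_upairV/e/memV_upairV; right; apply: eqV_refl.
  - have /memV_upairV[/eqV_sym|/eqV_sym] : memV x' (upairV x y); [|by left|by right].
    by apply/e/memV_upairV; left; apply: eqV_refl.
  - have /memV_upairV[/eqV_sym|/eqV_sym] : memV y' (upairV x y); [|by left|by right].
    by apply/e/memV_upairV; right; apply: eqV_refl.
move=> /upairE[p1 p2 _ p4]; have aa' : eqV a a'.
  by case: p1 => /upairE[_ _ []].
split=> //; have bb' : eqV b a' -> eqV a b' -> eqV b b'.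
  by move=> ba' ab'; apply: eqV_trans ba' (eqV_trans (eqV_sym aa') ab').
have abE : eqV (upairV a b) (upairV a' b') -> eqV b b'.
  by move=> /upairE[_ [ba'|//] _ [ab'|//]]; apply: bb'.
case: p2 => [/upairE[_ ba' _ _]|//]; case: p4 => [/upairE[_ _ _ ab']|//].
by apply: bb'; [case: ba'|case: ab'].
Qed.

(** * Closure properties of first-order definability *)

Definition definable (P : seq V -> Prop) : Prop :=
  exists phi, forall env, sat env phi <-> P env.

Definition variable (t : seq V -> V) : Prop :=
  exists i, forall env, t env = nth emptyV env i.

Lemma definable_ext P Q :
  (forall env, P env <-> Q env) -> definable P -> definable Q.
Proof. by move=> PQ [phi phiP]; exists phi => env; rewrite phiP. Qed.

Lemma definable_mem t u : variable t -> variable u ->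
  definable (fun env => memV (t env) (u env)).
Proof. by move=> [i ti] [j uj]; exists (FMem i j) => env; rewrite ti uj. Qed.

Lemma definable_eq t u : variable t -> variable u ->
  definable (fun env => eqV (t env) (u env)).
Proof. by move=> [i ti] [j uj]; exists (FEq i j) => env; rewrite ti uj. Qed.

Lemma definable_not P : definable P -> definable (fun env => ~ P env).
Proof. by move=> [phi phiP]; exists (FNot phi) => env /=; rewrite phiP. Qed.

Lemma definable_and P Q : definable P -> definable Q ->
  definable (fun env => P env /\ Q env).
Proof.
move=> [phi phiP] [psi psiP]; exists (FAnd phi psi) => env /=.
by rewrite phiP psiP.
Qed.

(** The language has only negation, conjunction and the existential quantifier; the other
    connectives are recovered classically. *)
Lemma definable_imp P Q : definable P -> definable Q ->
  definable (fun env => P env -> Q env).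
Proof.
move=> dP dQ; apply: (@definable_ext (fun env => ~ (P env /\ ~ Q env))).
  move=> env; split=> [nPQ p|PQ [p]]; last by apply; apply: PQ.
  by apply: contrapT => q; apply: nPQ.
by apply/definable_not/definable_and => //; apply: definable_not.
Qed.

Lemma definable_or P Q : definable P -> definable Q ->
  definable (fun env => P env \/ Q env).
Proof.
move=> dP dQ; apply: (@definable_ext (fun env => ~ P env -> Q env)).
  move=> env; split=> [PQ|[//|//]].
  by have [|/PQ] := pselect (P env); [left|right].
by apply: definable_imp => //; apply: definable_not.
Qed.

Lemma definable_iff P Q : definable P -> definable Q ->
  definable (fun env => P env <-> Q env).
Proof. by move=> dP dQ; apply: definable_and; apply: definable_imp. Qed.

(** The bound variable is the head of the environment and the outer variables live in its tail. This
    is the de Bruijn shift, which [solve_variable] resolves through [nth_behead]. *)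
Lemma definable_ex (Q : seq V -> V -> Prop) :
  definable (fun env => Q (behead env) (head emptyV env)) ->
  definable (fun env => exists a, Q env a).
Proof.
move=> [phi phiP]; exists (FEx phi) => env /=.
have phiQ a : sat (a :: env) phi <-> Q env a := phiP (a :: env).
by split=> -[a /phiQ]; exists a.
Qed.

Lemma definable_all (Q : seq V -> V -> Prop) :
  definable (fun env => Q (behead env) (head emptyV env)) ->
  definable (fun env => forall a, Q env a).
Proof.
move=> dQ; apply: (@definable_ext (fun env => ~ exists a, ~ Q env a)).
  move=> env; split=> [nQ a|Qenv [a]//].
  by apply: contrapT => Qa; apply: nQ; exists a.
by apply/definable_not/(definable_ex (Q := fun env a => ~ Q env a))/definable_not.
Qed.

Ltac solve_variable := by eexists => env; rewrite -?nth0 ?nth_behead.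

(** Pairs are not terms of the language, so the equation is unfolded by extensionality. *)
Lemma definable_eq_upair t u v : variable t -> variable u -> variable v ->
  definable (fun env => eqV (t env) (upairV (u env) (v env))).
Proof.
move=> [i ti] [j uj] [k vk].
apply: (@definable_ext (fun env => forall x, memV x (nth emptyV env i) <->
    eqV x (nth emptyV env j) \/ eqV x (nth emptyV env k))); last first.
  apply/definable_all/definable_iff; last apply: definable_or.
  - by apply: definable_mem; solve_variable.
  - by apply: definable_eq; solve_variable.
  - by apply: definable_eq; solve_variable.
move=> env; rewrite ti uj vk; split=> [e|/eqVP e x].
  by apply/eqVP => x; rewrite memV_upairV.
by rewrite e memV_upairV.
Qed.

Lemma definable_eq_pair t u v : variable t -> variable u -> variable v ->
  definable (fun env => eqV (t env) (pairV (u env) (v env))).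
Proof.
move=> [i ti] [j uj] [k vk].
apply: (@definable_ext (fun env => exists x, exists y,
    eqV x (upairV (nth emptyV env j) (nth emptyV env j)) /\
    (eqV y (upairV (nth emptyV env j) (nth emptyV env k)) /\
     eqV (nth emptyV env i) (upairV x y)))).
  move=> env; rewrite ti uj vk; split=> [[x [y [ex [ey e]]]]|e].
    by apply: eqV_trans e (upairV_congr ex ey).
  by do 2![eexists]; do 2![split; first exact: eqV_refl].
do 2!apply: definable_ex.
by apply: definable_and; [|apply: definable_and];
  apply: definable_eq_upair; solve_variable.
Qed.

Lemma definable_mem_pair t u v : variable t -> variable u -> variable v ->
  definable (fun env => memV (pairV (t env) (u env)) (v env)).
Proof.
move=> [i ti] [j uj] [k vk].
apply: (@definable_ext (fun env => exists x,
    eqV x (pairV (nth emptyV env i) (nth emptyV env j)) /\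
    memV x (nth emptyV env k))); last first.
  apply/definable_ex/definable_and.
  - by apply: definable_eq_pair; solve_variable.
  - by apply: definable_mem; solve_variable.
move=> env; rewrite ti uj vk memVP; split=> [[x [/eqV_sym]]|[x /eqV_sym]];
  by exists x.
Qed.

Ltac solve_definable := cbn beta; first
  [ apply: definable_mem; solve_variable
  | apply: definable_eq; solve_variable
  | apply: definable_eq_pair; solve_variable
  | apply: definable_mem_pair; solve_variable
  | apply: definable_and; solve_definable
  | apply: definable_or; solve_definable
  | apply: definable_iff; solve_definable
  | apply: definable_not; solve_definable
  | apply: definable_imp; solve_definable
  | apply: definable_ex; solve_definable
  | apply: definable_all; solve_definable ].

(** * First-order description of the sequence of colorings *)

Definition is_inductive (I : V) : Prop :=
  (exists e, (forall y, ~ memV y e) /\ memV e I) /\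
  (forall a, memV a I -> exists s,
    (forall y, memV y s <-> memV y a \/ eqV y a) /\ memV s I).

Definition is_natural (k : V) : Prop := forall I, is_inductive I -> memV k I.

(** The set [Sup natV] of all numerals is itself inductive, and conversely every inductive set
    contains all numerals by induction. *)
Lemma is_naturalP k : is_natural k <-> exists n, eqV k (natV n).
Proof.
split=> [k_nat|[n kn] I [[e [e0 eI]] succI]].
  suff : is_inductive (Sup natV) by move=> /k_nat.
  split=> [|a [n an]].
    by exists (natV 0); split=> [y|]; [case|exists 0; apply: eqV_refl].
  exists (succV a); split; first exact: memV_succV.
  exists n.+1; apply/eqVP => y; rewrite [natV _]/(succV (natV n)) !memV_succV.
  by split=> -[ya|ya]; [left; apply: memV_eq ya; rewrite //; apply: eqV_refl
    |right; apply: eqV_trans ya an|left; apply: memV_eq ya;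
    [apply: eqV_refl|apply: eqV_sym]|right; apply: eqV_trans ya (eqV_sym an)].
apply/memVP; exists (natV n) => //; elim: n {k kn} => [|n /succI[s [sE sI]]].
  apply/memVP; exists e => //; apply/eqVP => y.
  by split=> [[]|/e0].
apply/memVP; exists s => //; apply/eqVP => y.
by rewrite [natV _]/(succV (natV n)) memV_succV sE.
Qed.

(* The bound on the size of the domain is expressed by a partial map [g] from
   [k] whose range covers the domain. *)
Definition is_bounded_coloring (X G k p : V) : Prop :=
  (forall z, memV z p -> exists x, exists j,
    memV x X /\ memV j k /\ eqV z (pairV x j)) /\
  (forall x j j', memV (pairV x j) p -> memV (pairV x j') p -> eqV j j') /\
  (exists g,
    (forall x j, memV (pairV x j) p -> exists i,
      memV i k /\ memV (pairV i x) g) /\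
    (forall i x x', memV (pairV i x) g -> memV (pairV i x') g -> eqV x x')) /\
  (forall s j, memV s G -> ~ forall x, memV x s -> memV (pairV x j) p).

Definition is_coloring_sequence (b X G : V) : Prop :=
  forall z, memV z b <-> exists k, exists A, eqV z (pairV k A) /\
    is_natural k /\ forall p, memV p A <-> is_bounded_coloring X G k p.

Lemma definable_coloring_sequence : definable (fun env =>
  is_coloring_sequence (nth emptyV env 0) (nth emptyV env 1) (nth emptyV env 2)).
Proof.
rewrite /is_coloring_sequence /is_natural /is_inductive /is_bounded_coloring.
solve_definable.
Qed.

(** * Correctness of the first-order description *)

Section Definability.
Variables (X : choiceType) (Gamma : set {fset X}) (iota : X -> V).
Hypothesis iota_inj : forall x y : X, eqV (iota x) (iota y) -> x = y.
Hypothesis Gamma3 : hypergraph 3 Gamma.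

Lemma memV_carrierV a : memV a (carrierV iota) <-> exists x, eqV a (iota x).
Proof. by rewrite memV_setV; split=> [[x _]|[x]]; exists x. Qed.

Lemma memV_fsetV a s : memV a (fsetV iota s) <-> exists2 x, x \in s & eqV a (iota x).
Proof. exact: memV_setV. Qed.

Lemma memV_fmapV (q : {fmap X -> nat}) z : memV z (fmapV iota q) <->
  exists x c, q.[? x]%fmap = Some c /\ eqV z (pairV (iota x) (natV c)).
Proof.
split=> [[x zx]|[x [c [qx zx]]]].
  by exists (val x), (q x); rewrite Some_fnd.
have xq := fnd_domf qx; exists [` xq]%fset.
by move: qx; rewrite in_fnd => -[->].
Qed.

Lemma mem_pairV_fmapV (q : {fmap X -> nat}) a j :
  memV (pairV a j) (fmapV iota q) <->
  exists x c, [/\ q.[? x]%fmap = Some c, eqV a (iota x) & eqV j (natV c)].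
Proof.
rewrite memV_fmapV; split=> [[x [c [qx /pairV_inj[ax jc]]]]|[x [c [qx ax jc]]]].
  by exists x, c.
by exists x, c; split=> //; apply: pairV_congr.
Qed.

Lemma fmapV_bounded_coloring n k (q : coloring_poset Gamma) p :
  (forall j, memV j k <-> exists2 i, i < n & eqV j (natV i)) ->
  bounded_colorings Gamma n q -> eqV p (fmapV iota (val q)) ->
  is_bounded_coloring (carrierV iota) (hypergraphV Gamma iota) k p.
Proof.
move=> kE [qn qc] pq.
have pE a j : memV (pairV a j) p <->
    exists x c, [/\ (val q).[? x]%fmap = Some c, eqV a (iota x) & eqV j (natV c)].
  by rewrite -mem_pairV_fmapV; move/eqVP: pq.
split; [|split; [|split]].
- move=> z /(memV_eq (eqV_refl z) pq)/memV_fmapV[x [c [qx zx]]].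
  exists (iota x), (natV c); split.
    by apply/memV_carrierV; exists x; apply: eqV_refl.
  by split=> //; apply/kE; exists c; [apply: qc qx|apply: eqV_refl].
- move=> a j j' /pE[x [c [qx ax jc]]] /pE[y [c' [qy ay jc']]].
  have xy := iota_inj (eqV_trans (eqV_sym ax) ay).
  move: qx; rewrite xy qy => -[cc']; rewrite cc' in jc'.
  exact: eqV_trans jc (eqV_sym jc').
- pose g := Sup (fun x : domf (val q) =>
    pairV (natV (index (val x) (domf (val q)))) (iota (val x))).
  have gE i a : memV (pairV i a) g <-> exists x : domf (val q),
      eqV i (natV (index (val x) (domf (val q)))) /\ eqV a (iota (val x)).
    split=> -[x]; [move=> /pairV_inj|move=> [ix ax]]; exists x => //.
    exact: pairV_congr.
  exists g; split=> [a j /pE[x [c [qx ax _]]]|i a a' /gE[x [ix ax]] /gE[y [iy ay]]].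
    have xq := fnd_domf qx; exists (natV (index x (domf (val q)))); split.
      apply/kE; exists (index x (domf (val q))); last exact: eqV_refl.
      by apply: leq_trans qn; rewrite index_mem.
    by apply/gE; exists [` xq]%fset; split=> //; apply: eqV_refl.
  have /natV_inj/(congr1 (nth (val x) (domf (val q)))) :=
    eqV_trans (eqV_sym ix) iy.
  rewrite !nth_index; [|exact: valP|exact: valP] => xy; rewrite -xy in ay.
  exact: eqV_trans ax (eqV_sym ay).
move=> s j /memV_setV[t Gt /eqVP st] sj.
have tj x : x \in t -> exists2 c, (val q).[? x]%fmap = Some c & eqV j (natV c).
  move=> xt; have /sj/pE[y [c [qy /iota_inj -> jc]]] : memV (iota x) s.
    by apply/st/memV_fsetV; exists x => //; apply: eqV_refl.
  by exists c.
have /asboolP/(_ t Gt) := valP q; apply.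
  by apply/fsubsetP => x /tj[c /fnd_domf].
move=> x y /tj[c -> jc] /tj[c' -> jc'].
by rewrite (natV_inj (eqV_trans (eqV_sym jc) jc')).
Qed.

Lemma is_bounded_coloring_fmapV n k p :
  (forall j, memV j k <-> exists2 i, i < n & eqV j (natV i)) ->
  is_bounded_coloring (carrierV iota) (hypergraphV Gamma iota) k p ->
  exists2 q, bounded_colorings Gamma n q & eqV p (fmapV iota (val q)).
Proof.
move=> kE [pX [pfun [[g [pg gfun]] pG]]].
have memV_pair a a' j j' r : eqV a a' -> eqV j j' -> memV (pairV a j) r ->
    memV (pairV a' j') r.
  by move=> aa' jj'; apply: memV_eq; [apply: pairV_congr|apply: eqV_refl].
pose P x c := memV (pairV (iota x) (natV c)) p.
(* [F i] is the vertex that [g] assigns to the numeral [i], if any. Its values below [n] cover the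
   domain, giving both finiteness and the size bound. *)
pose F i : option X := if pselect (exists x, memV (pairV (natV i) (iota x)) g)
  is left h then Some (projT1 (cid h)) else None.
have PF x c : P x c -> x \in pmap F (seq.iota 0 n).
  move=> /pg[i [/kE[j jn ij] ix]]; rewrite mem_pmap; apply/mapP.
  exists j; first by rewrite mem_iota.
  have {ix} jx : memV (pairV (natV j) (iota x)) g.
    by apply: memV_pair ix => //; apply: eqV_refl.
  rewrite /F; case: pselect => [h|[]]; last by exists x.
  by congr Some; apply: iota_inj; apply: gfun jx (projT2 (cid h)).
have [x c /PF xF|x c c' Pc Pc'|q qP] :=
    @fmap_of_rel X [fset x in pmap F (seq.iota 0 n)]%fset P.
- by rewrite in_fset.
- exact/natV_inj/(pfun _ _ _ Pc Pc').
have Pn x c : P x c -> c < n.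
  move=> /pX[a [j [_ [/kE[i lt_in ji]]]]] /pairV_inj[_ cj].
  by rewrite (natV_inj (eqV_trans cj ji)).
have q_col : partial_coloring Gamma q.
  move=> t Gt /fsubsetP tq mono.
  (* The last clause of the description names the common color; it is read off at the vertex
     [x0]. *)
  have /fset3P[x0 [x1 [x2 tE]]] := Gamma3 Gt.
  have x0t : x0 \in t by rewrite tE !inE eqxx.
  have [c qx0] := domf_fnd (tq _ x0t).
  apply: (pG (fsetV iota t) (natV c)).
    by apply/memV_setV; exists t => //; apply: eqV_refl.
  move=> a /memV_fsetV[x xt /eqV_sym xa].
  apply: memV_pair xa (eqV_refl _) _; apply/qP.
  by rewrite -qx0; apply: mono.
exists (exist _ q (asboolT q_col)); first split=> [|x c /qP/Pn//].
  apply: (@leq_trans (size (pmap F (seq.iota 0 n)))).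
    apply: uniq_leq_size => // x xq.
    by have [c /qP/PF] := domf_fnd (xq : x \in domf q).
  by rewrite size_pmap -[X in _ <= X](size_iota 0) count_size.
apply/eqVP => z; rewrite memV_fmapV; split=> [zp|[x [c [/qP Pxc zx]]]].
  have [a [j [/memV_carrierV[x ax] [/kE[c _ jc] zaj]]]] := pX z zp.
  have zxc := eqV_trans zaj (pairV_congr ax jc).
  by exists x, c; split=> //; apply/qP; apply: memV_eq zp => //; apply: eqV_refl.
by apply: memV_eq Pxc => //; [apply: eqV_sym|apply: eqV_refl].
Qed.

Lemma definable_bounded_colorings :
  definable_from [:: carrierV iota; hypergraphV Gamma iota]
    (sequenceV iota (bounded_colorings Gamma)).
Proof.
(* One formula serves for all [X] and [Gamma]. By extensionality its description of the members of
   [b] determines [b] up to [eqV]. *)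
have [phi phiP] := definable_coloring_sequence.
exists phi => b; rewrite phiP /=.
pose An n := setV (bounded_colorings Gamma n) (fun p => fmapV iota (val p)).
have AnE n k p : eqV k (natV n) -> memV p (An n) <->
    is_bounded_coloring (carrierV iota) (hypergraphV Gamma iota) k p.
  move=> /eqVP kn; have kE j : memV j k <-> exists2 i, i < n & eqV j (natV i).
    by rewrite kn memV_natV.
  rewrite memV_setV; split=> [[q]|]; first exact: fmapV_bounded_coloring.
  exact: is_bounded_coloring_fmapV.
have seqE z : memV z (sequenceV iota (bounded_colorings Gamma)) <->
    exists k, exists A, eqV z (pairV k A) /\ is_natural k /\ forall p,
      memV p A <-> is_bounded_coloring (carrierV iota) (hypergraphV Gamma iota) k p.
  rewrite memV_setV; split=> [[n _ zn]|[k [A [zkA [/is_naturalP[n kn] AE]]]]].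
    exists (natV n), (An n); split=> //; split=> [|p].
      by apply/is_naturalP; exists n; apply: eqV_refl.
    exact/AnE/eqV_refl.
  exists n => //; apply: eqV_trans zkA (pairV_congr kn _).
  by apply/eqVP => p; rewrite AE; apply: iff_sym; apply: AnE.
rewrite eqVP; split=> bE z; first by rewrite bE seqE.
by rewrite bE seqE.
Qed.

End Definability.

Theorem theorem3p3 (X : choiceType) (iota : X -> V)
    (iota_inj : forall x y : X, eqV (iota x) (iota y) -> x = y)
    (Gamma : set {fset X}) (Gamma3 : hypergraph 3 Gamma)
    (Gamma_bounded : exists d : nat, forall x0 x1 : X,
       [set x2 : X | Gamma [fset x0; x1; x2]%fset] #<= `I_d) :
  definably_sigma_ramsey_centered Gamma iota.
Proof.
have [d Gamma_d] := Gamma_bounded.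
exists (bounded_colorings Gamma); split.
- by move=> k; apply: (bounded_colorings_ramsey_centered Gamma3 Gamma_d).
- exact: bounded_colorings_cover.
- exact: definable_bounded_colorings.
Qed.
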